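(* Let $\Lambda=\{\Lambda_i\}_{i\in I}$ and $\Gamma=\{\Gamma_i\}_{i\in I}$ be g-frames for $\mathcal H$ with respect to $\{\mathcal K_i\}_{i\in I}$, and let $U=\mathrm{diag}\{u_i\}_{i\in I}$ be a semi-normalized bounded diagonal operator on $\ell^2(\oplus_{i\in I}\mathcal K_i)$. If $M_{U,\Lambda,\Gamma}$ is invertible, then there exists a unique dual g-frame $\Gamma^{\dagger}=\{\Gamma^{\dagger}_i\}_{i\in I}$ of $\Gamma$ such that $$M_{U,\Lambda,\Gamma}^{-1}=M_{U^{-1},\Gamma^{\dagger},\Lambda^{d}}$$ for all dual g-frames $\Lambda^{d}$ of $\Lambda$.
   Context: $\mathcal H,\mathcal K$ are separable Hilbert spaces, $I\subseteq\mathbb Z$, and $\{\mathcal K_i\}_{i\in I}$ is a sequence of closed subspaces of $\mathcal K$. $\ell^2(\oplus_{i\in I}\mathcal K_i)$ is the Hilbert space of sequences $\{x_i\}_{i\in I}$ with $x_i\in\mathcal K_i$ and $\sum_i\|x_i\|^2<\infty$, with inner product $\langle\{x_i\},\{y_i\}\rangle=\sum_i\langle x_i,y_i\rangle$. A sequence $\Lambda=\{\Lambda_i\}_{i\in I}$ with $\Lambda_i\in B(\mathcal H,\mathcal K_i)$ is a g-frame for $\mathcal H$ with respect to $\{\mathcal K_i\}$ if there are constants $A_\Lambda,B_\Lambda>0$ with $A_\Lambda\|x\|^2\le\sum_{i}\|\Lambda_ix\|^2\le B_\Lambda\|x\|^2$ for all $x\in\mathcal H$; it is a g-Bessel sequence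 if only the upper inequality is required. For a g-Bessel sequence, the synthesis operator is $T_\Lambda:\ell^2(\oplus_i\mathcal K_i)\to\mathcal H$, $T_\Lambda\{x_i\}=\sum_i\Lambda_i^*x_i$, and its adjoint is the analysis operator $T_\Lambda^*x=\{\Lambda_ix\}_{i\in I}$. A g-frame $\Lambda^d=\{\Lambda^d_i\}$ is a dual g-frame of the g-frame $\Lambda$ if $x=\sum_i\Lambda_i^*\Lambda^d_ix$ for all $x\in\mathcal H$, i.e. $T_\Lambda T_{\Lambda^d}^*=Id_{\mathcal H}$. $U=\mathrm{diag}\{u_i\}_{i\in I}$, $u_i\in B(\mathcal K_i)$, denotes the bounded operator $\{x_i\}\mapsto\{u_ix_i\}$ on $\ell^2(\oplus_i\mathcal K_i)$. It is semi-normalized if every $u_i$ is invertible and $U^{-1}:\{x_i\}\mapsto\{u_i^{-1}x_i\}$ is a bounded operator on $\ell^2(\oplus_i\mathcal K_i)$. For g-Bessel sequences $\Lambda,\Gamma$ and such $U$, the generalized multiplier is $M_{U,\Lambda,\Gamma}=T_\Lambda UT_\Gamma^*\in B(\mathcal H)$, i.e. $M_{U,\Lambda,\Gamma}x=\sum_i\Lambda_i^*u_i\Gamma_ix$. ''Invertible'' means bijective with bounded inverse. *)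

(* Defs.v *)
From HB Require Import structures.
From mathcomp Require Import all_boot all_order all_algebra finmap complex.
From mathcomp Require Import sesquilinear.
From mathcomp Require Import all_classical all_reals all_analysis.
From mathcomp Require Export summability.

Set Implicit Arguments.
Unset Strict Implicit.
Unset Printing Implicit Defensive.

Import Order.TTheory GRing.Theory Num.Theory.
Import numFieldNormedType.Exports.

Local Open Scope classical_set_scope.
Local Open Scope ring_scope.

(* The scalar field of the Hilbert spaces is R or C = R[i]. *)
Variant scalar_kind := RealScalars | ComplexScalars.

Definition scalars (R : realType) (k : scalar_kind) : numFieldType :=
  match k with
  | RealScalars => R
  | ComplexScalars => R[i]
  end.

Definition scalar_conj (R : realType) (k : scalar_kind) :
    scalars R k -> scalars R k :=
  match k with
  | RealScalars => idfun
  | ComplexScalars => Num.conj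
  end.

Definition scalar_re (R : realType) (k : scalar_kind) : scalars R k -> R :=
  match k with
  | RealScalars => idfun
  | ComplexScalars => @complex.Re R
  end.

(* [hdot] is linear in its first argument and conjugate-linear in its second
   one; Hermitian symmetry and positive definiteness are part of [{dot _}]. *)
HB.mixin Record CompleteNormedModule_isHilbert (R : realType) (k : scalar_kind)
    V & CompleteNormedModule (scalars R k) V := {
  hdot : {dot V for @scalar_conj R k};
  sqr_norm_hdot : forall x : V, `|x| ^+ 2 = hdot x x
}.

#[short(type="hilbertType")]
HB.structure Definition Hilbert (R : realType) (k : scalar_kind) :=
  {V of CompleteNormedModule (scalars R k) V
   & CompleteNormedModule_isHilbert R k V}.

(* In MathComp-Analysis the norm of a module over F takes its values in F; the
   values are nonnegative, hence real, and [hnorm x] is the same number in R. *)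
Definition hnorm (R : realType) (k : scalar_kind) (V : hilbertType R k)
    (x : V) : R :=
  scalar_re `|x|.

Definition separable (T : topologicalType) : Prop :=
  exists D : set T, countable D /\ dense D.

Section closed_subspace.
Variables (R : realType) (k : scalar_kind) (V : hilbertType R k).

Record closed_subspace := ClosedSubspace {
  subspace_set : set V;
  subspace_submod : GRing.submod_closed (mem subspace_set);
  subspace_closed : closed subspace_set
}.

Definition subspace_pred (S : closed_subspace) : {pred V} :=
  mem (subspace_set S).

HB.instance Definition _ (S : closed_subspace) :=
  GRing.isSubmodClosed.Build (scalars R k) V (subspace_pred S)
    (subspace_submod S).

Record subspace_elt (S : closed_subspace) := SubspaceElt {
  subspace_val : V;
  subspace_valP : subspace_val \in subspace_pred S
}.

End closed_subspace.

Coercion subspace_elt : closed_subspace >-> Sortclass.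

(* A closed subspace of a Hilbert space is a Hilbert space for the inherited
   operations, norm and inner product. *)
Section subspace_hilbert.
Variables (R : realType) (k : scalar_kind) (V : hilbertType R k).
Variable S : closed_subspace V.

HB.instance Definition _ := [isSub for @subspace_val R k V S].
HB.instance Definition _ := [Choice of S by <:].
HB.instance Definition _ := [SubChoice_isSubLmodule of S by <:].

Let snorm (x : S) : scalars R k := `|\val x|.

Let snormD (x y : S) : snorm (x + y) <= snorm x + snorm y.
Proof. by rewrite /snorm raddfD ler_normD. Qed.

Let snormZ (a : scalars R k) (x : S) : snorm (a *: x) = `|a| * snorm x.
Proof. by rewrite /snorm linearZ normrZ. Qed.

Let snorm0 (x : S) : snorm x = 0 -> x = 0.
Proof.
by move=> /normr0_eq0 x0; apply: val_inj; rewrite x0 raddf0.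
Qed.

HB.instance Definition _ :=
  @Lmodule_isNormed.Build (scalars R k) S snorm snormD snormZ snorm0.

Let subspace_complete (F : set_system S) : ProperFilter F -> cauchy F -> cvg F.
Proof.
move=> FF /cauchy_ballP Fc.
have GF : ProperFilter ((\val : S -> V) @ F) by apply: fmap_proper_filter.
have /cvg_ex[/= l Gl] : cvg ((\val : S -> V) @ F).
  apply: cauchy_cvg; apply/cauchy_ballP => e e0.
  have [[A B] /= [FA FB] AB] := Fc e e0.
  exists (\val @` A, \val @` B) => [|_ [[x Ax <-] [y By <-]]] /=.
    split => /=; rewrite /nbhs /=.
      by apply: filterS FA => x Ax; exists x.
    by apply: filterS FB => x Bx; exists x.
  move: (AB (x, y) (conj Ax By)); rewrite -!ball_normE /=.
  by rewrite -[subspace_val x - _](raddfB (\val : S -> V)).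
have Sl : l \in subspace_pred S.
  rewrite inE; apply: (@closed_cvg _ _ _ FF (\val : S -> V) (subspace_set S)).
  - exact: subspace_closed.
  - by apply: nearW => x; have := subspace_valP x; rewrite inE.
  - exact: Gl.
apply/cvg_ex; exists (SubspaceElt Sl).
apply/cvgrPdist_lt => e e0; move/cvgrPdist_lt : Gl => /(_ e e0).
exact.
Qed.

HB.instance Definition _ :=
  Uniform_isComplete.Build S subspace_complete.

Let sdot (x y : S) : scalars R k := hdot (\val x) (\val y).

Let sdot_zmodl y : zmod_morphism (sdot^~ y).
Proof. by move=> x x'; rewrite /sdot raddfB linearBl. Qed.

Let sdot_zmodr x : zmod_morphism (sdot x).
Proof. by move=> y y'; rewrite /sdot [\val (y - y')](raddfB (\val : S -> V)) raddfB. Qed.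

Let sdotZl y : scalable_for *%R (sdot^~ y).
Proof. by move=> a x; rewrite /sdot linearZ linearZl_LR. Qed.

Let sdotZr x : scalable_for (@scalar_conj R k \; *%R) (sdot x).
Proof.
move=> a y; rewrite /sdot [\val (a *: y)](linearZ_LR (\val : S -> V)).
exact: linearZr_LR.
Qed.

Let sdotC x y : sdot x y = (-1) ^+ false * scalar_conj (sdot y x).
Proof. exact: hermitian_subproof. Qed.

Let sdot_gt0 x : x != 0 -> 0 < sdot x x.
Proof.
move=> x0; apply: neq0_dnorm_gt0; apply: contra x0 => /eqP x0.
by apply/eqP/val_inj; rewrite x0 raddf0.
Qed.

HB.instance Definition _ := isBilinear.Build (scalars R k) S S (scalars R k)
  *%R (@scalar_conj R k \; *%R) sdot sdot_zmodl sdot_zmodr sdotZl sdotZr.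

HB.instance Definition _ := isHermitianSesquilinear.Build (scalars R k) S
  false (@scalar_conj R k) sdot sdotC.

HB.instance Definition _ := isDotProduct.Build (scalars R k) S sdot sdot_gt0.

Let sqr_norm_sdot (x : S) : `|x| ^+ 2 = sdot x x.
Proof. exact: sqr_norm_hdot. Qed.

HB.instance Definition _ := CompleteNormedModule_isHilbert.Build R k S
  (sqr_norm_sdot : forall x : S,
     `|x| ^+ 2 = (sdot : {dot S for @scalar_conj R k}) x x).

End subspace_hilbert.

Section operators.
Variables (R : realType) (k : scalar_kind) (V W : hilbertType R k).

Definition bounded_linear (f : V -> W) : Prop :=
  linear f /\ exists C : R, forall x, hnorm (f x) <= C * hnorm x.

(* For bounded linear [f] the Riesz representation theorem makes the set below
   a singleton. *)
Definition adjoint (f : V -> W) (y : W) : V :=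
  xget 0 [set z | forall x, hdot (f x) y = hdot x z].

(* [pinv setT f] is the two-sided inverse of [f] when [f] is bijective. *)
Definition inverse (f : V -> W) : W -> V := pinv [set: V] f.

End operators.

Definition invertible (R : realType) (k : scalar_kind) (V W : hilbertType R k)
    (f : V -> W) : Prop :=
  bijective f /\ bounded_linear (inverse f).

Section gframes.
Variables (R : realType) (k : scalar_kind) (H K : hilbertType R k).
Variables (I : set int) (K_ : I -> closed_subspace K).

Definition sqr_sum (x : forall i, K_ i) : \bar R :=
  \esum_(i in [set: I]) ((hnorm (x i)) ^+ 2)%:E.

Definition l2 : set (forall i, K_ i) := [set x | (sqr_sum x < +oo)%E].

Definition l2_norm (x : forall i, K_ i) : R := Num.sqrt (fine (sqr_sum x)).

Definition l2_bounded (T : (forall i, K_ i) -> (forall i, K_ i)) : Prop :=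
  exists C : R, forall x, l2 x -> l2 (T x) /\ l2_norm (T x) <= C * l2_norm x.

Definition diag (u : forall i, K_ i -> K_ i) (x : forall i, K_ i) :
  forall i, K_ i := fun i => u i (x i).

Definition diag_inv (u : forall i, K_ i -> K_ i) : forall i, K_ i -> K_ i :=
  fun i => inverse (u i).

Definition bounded_diag (u : forall i, K_ i -> K_ i) : Prop :=
  (forall i, bounded_linear (u i)) /\ l2_bounded (diag u).

Definition semi_normalized (u : forall i, K_ i -> K_ i) : Prop :=
  (forall i, invertible (u i)) /\ l2_bounded (diag (diag_inv u)).

Definition analysis_op (L : forall i, H -> K_ i) (x : H) : forall i, K_ i :=
  fun i => L i x.

(* [sum] is the limit of the net of finite partial sums; it exists when [L] is
   a g-Bessel sequence and [x] is in [l2]. *)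
Definition synthesis_op (L : forall i, H -> K_ i) (x : forall i, K_ i) : H :=
  sum (fun i => adjoint (L i) (x i)).

Definition gframe (L : forall i, H -> K_ i) : Prop :=
  (forall i, bounded_linear (L i)) /\
  exists A B : R, [/\ 0 < A, 0 < B & forall x : H,
    ((A * hnorm x ^+ 2)%:E <= sqr_sum (analysis_op L x) <=
     (B * hnorm x ^+ 2)%:E)%E].

(* For a g-frame [L]. *)
Definition dual_gframe (L Ld : forall i, H -> K_ i) : Prop :=
  gframe Ld /\ forall x, synthesis_op L (analysis_op Ld x) = x.

Definition multiplier (u : forall i, K_ i -> K_ i)
    (L G : forall i, H -> K_ i) : H -> H :=
  synthesis_op L \o diag u \o analysis_op G.

End gframes.

(* Main.v *)
(* Write M for the multiplier and N for its inverse.  The dual of Gamma is forced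
   to have synthesis operator N T_Lambda U, i.e. Gd_i = u_i^* Lambda_i N^*; then
   T_Gd T_Gamma^* = N M = Id, and taking adjoints Gd is a dual of Gamma.

   Conversely T_Lambda (U T_Gamma^* N) = M N = Id, so Cd_i = u_i Gamma_i N is a dual
   of Lambda, and so is Cd + <., h> z for every h and every z in ker T_Lambda.
   Comparing the required formula on these duals shows that the synthesis
   operator of a solution, composed with U^-1, vanishes on ker T_Lambda and agrees
   with N T_Lambda on the range of T_Cd^*, hence on all of l2. *)
Require Import Defs.
From mathcomp Require Import all_boot all_order all_algebra finmap complex.
From mathcomp Require Import sesquilinear.
From mathcomp Require Import all_classical all_reals all_analysis.
From mathcomp Require Import ring lra.

Set Implicit Arguments.
Unset Strict Implicit.
Unset Printing Implicit Defensive.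

Import Order.TTheory GRing.Theory Num.Theory.
Import numFieldNormedType.Exports.

Local Open Scope classical_set_scope.
Local Open Scope ring_scope.

(** * Real numbers inside the scalar field, and real parts *)

Definition scalar_of_real (R : realType) (k : scalar_kind) : R -> scalars R k :=
  match k with
  | RealScalars => idfun
  | ComplexScalars => fun r => (r%:C)%C
  end.

Section scalars.
Variables (R : realType) (k : scalar_kind).
Implicit Types (a b : scalars R k) (r s : R).
Local Notation re := (@scalar_re R k).
Local Notation "r %:S" := (@scalar_of_real R k r) (at level 2, format "r %:S").

Lemma scalar_reD a b : re (a + b) = re a + re b.
Proof. by move: a b; rewrite /scalar_re; case: k => //= -[? ?] [? ?]. Qed.

Lemma scalar_reN a : re (- a) = - re a.
Proof. by move: a; rewrite /scalar_re; case: k => //= -[? ?]. Qed.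

Lemma scalar_reB a b : re (a - b) = re a - re b.
Proof. by rewrite scalar_reD scalar_reN. Qed.

Lemma scalar_re0 : re 0 = 0.
Proof. by rewrite /scalar_re; case: k. Qed.

Lemma scalar_re1 : re 1 = 1.
Proof. by rewrite /scalar_re; case: k. Qed.

Lemma scalar_reZ r a : re (r%:S * a) = r * re a.
Proof.
move: a; rewrite /scalar_re /scalar_of_real; case: k => //= -[x y] /=.
by rewrite mul0r subr0.
Qed.

Lemma scalar_of_real0 : 0%:S = 0.
Proof. by rewrite /scalar_of_real; case: k. Qed.

Lemma scalar_of_realK : cancel (@scalar_of_real R k) re.
Proof. by rewrite /scalar_re /scalar_of_real; case: k. Qed.

Lemma scalar_re_conj a : re (scalar_conj a) = re a.
Proof. by move: a; rewrite /scalar_re /scalar_conj; case: k => //= -[]. Qed.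

Lemma scalar_re_conjM a : re (scalar_conj a * a) = re `|a| ^+ 2.
Proof.
move: a; rewrite /scalar_re /scalar_conj; case: k => [|] a.
  by rewrite real_normK ?num_real.
rewrite normc_def /= sqr_sqrtr ?addr_ge0 ?sqr_ge0//.
by case: a => x y /=; ring.
Qed.

Lemma scalar_normE a : `|a| = (re `|a|)%:S.
Proof.
by move: a; rewrite /scalar_re /scalar_of_real; case: k => //= a; rewrite normc_def.
Qed.

Lemma ler_scalar_re a b : a <= b -> re a <= re b.
Proof. by move: a b; rewrite /scalar_re; case: k => //= a b; rewrite lecE => /andP[]. Qed.

Lemma scalar_re_norm_ge0 a : 0 <= re `|a|.
Proof. by rewrite -scalar_re0; apply: ler_scalar_re. Qed.

Lemma ltr_scalar_of_real r s : (r%:S < s%:S) = (r < s).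
Proof. by rewrite /scalar_of_real; case: k => //=; exact: ltcR. Qed.

Lemma scalar_of_realM r s : (r * s)%:S = r%:S * s%:S.
Proof. by rewrite /scalar_of_real; case: k => //=; rewrite rmorphM. Qed.

(** The order of [R[i]] compares only numbers with equal imaginary parts, so a positive scalar is
    real. This lets the tolerances of filter convergence be taken in [R]. *)
Lemma scalar_gt0 a : 0 < a -> a = (re a)%:S /\ 0 < re a.
Proof.
move=> a0; have aE : a = (re a)%:S by rewrite -(gtr0_norm a0) -scalar_normE.
by split=> //; rewrite -ltr_scalar_of_real -aE scalar_of_real0.
Qed.

Lemma scalar_of_real_gt0 r : 0 < r -> 0 < r%:S.
Proof. by rewrite -ltr_scalar_of_real scalar_of_real0. Qed.

(** For nonzero [a] the choice [b = a^-1] would give real part 1. This lifts identities between real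
    parts to identities between scalars. *)
Lemma scalar_re_eq0 a : (forall b, re (b * a) = 0) -> a = 0.
Proof.
move=> a0; apply/eqP; apply: contraT => /mulVf a1.
by have := a0 a^-1; rewrite a1 scalar_re1 => /eqP; rewrite oner_eq0.
Qed.

End scalars.

(** * Real geometry of a Hilbert space and convergence with real tolerances *)

Section hilbert_geometry.
Variables (R : realType) (k : scalar_kind) (V : hilbertType R k).
Implicit Types x y z : V.
Local Notation re := (@scalar_re R k).
Local Notation "r %:S" := (@scalar_of_real R k r) (at level 2, format "r %:S").

(** A real inner product with the same norm, so that estimates are carried out once for both scalar
    fields. *)
Definition rdot x y : R := re (hdot x y).

Lemma hdotC x y : hdot x y = scalar_conj (hdot y x).
Proof.
pose f : {hermitian V for false & @scalar_conj R k} := @hdot R k V.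
by have := @hermitian_subproof _ _ _ _ f x y; rewrite expr0 mul1r.
Qed.

Lemma hdotDl x y z : hdot (x + y) z = hdot x z + hdot y z.
Proof. exact: (linearDl (@hdot R k V)). Qed.

Lemma hdotNl x z : hdot (- x) z = - hdot x z.
Proof. exact: (linearNl (@hdot R k V)). Qed.

Lemma hdotZl a x z : hdot (a *: x) z = a * hdot x z.
Proof. exact: (linearZl_LR (@hdot R k V)). Qed.

Lemma hdot0l z : hdot 0 z = 0.
Proof. exact: (linear0l (@hdot R k V)). Qed.

Lemma rdotC x y : rdot x y = rdot y x.
Proof. by rewrite /rdot hdotC scalar_re_conj. Qed.

Lemma rdotDl x y z : rdot (x + y) z = rdot x z + rdot y z.
Proof. by rewrite /rdot hdotDl scalar_reD. Qed.

Lemma rdotNl x z : rdot (- x) z = - rdot x z.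
Proof. by rewrite /rdot hdotNl scalar_reN. Qed.

Lemma rdotZl r x z : rdot (r%:S *: x) z = r * rdot x z.
Proof. by rewrite /rdot hdotZl scalar_reZ. Qed.

Lemma rdotDr z x y : rdot z (x + y) = rdot z x + rdot z y.
Proof. by rewrite rdotC rdotDl !(rdotC z). Qed.

Lemma rdotNr z x : rdot z (- x) = - rdot z x.
Proof. by rewrite rdotC rdotNl (rdotC z). Qed.

Lemma rdotBr z x y : rdot z (x - y) = rdot z x - rdot z y.
Proof. by rewrite rdotDr rdotNr. Qed.

Lemma rdotBl x y z : rdot (x - y) z = rdot x z - rdot y z.
Proof. by rewrite rdotDl rdotNl. Qed.

Lemma rdotZr r z x : rdot z (r%:S *: x) = r * rdot z x.
Proof. by rewrite rdotC rdotZl rdotC. Qed.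

Lemma rdot0l z : rdot 0 z = 0.
Proof. by rewrite /rdot hdot0l scalar_re0. Qed.

Lemma rdot0r z : rdot z 0 = 0.
Proof. by rewrite rdotC rdot0l. Qed.

Lemma hnormE x : `|x| = (hnorm x)%:S.
Proof. by rewrite -[LHS]normr_id scalar_normE normr_id. Qed.

Lemma rdotxx x : rdot x x = hnorm x ^+ 2.
Proof.
rewrite /rdot -sqr_norm_hdot expr2 hnormE -scalar_of_realM scalar_of_realK.
by rewrite expr2.
Qed.

Lemma hnorm_ge0 x : 0 <= hnorm x.
Proof. by rewrite /hnorm -(scalar_re0 R k); apply: ler_scalar_re. Qed.

Lemma hnorm0 : hnorm (0 : V) = 0.
Proof. by rewrite /hnorm normr0 scalar_re0. Qed.

Lemma hnorm0_eq0 x : hnorm x = 0 -> x = 0.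
Proof. by move=> x0; apply: normr0_eq0; rewrite hnormE x0 scalar_of_real0. Qed.

Lemma hnormN x : hnorm (- x) = hnorm x.
Proof. by rewrite /hnorm normrN. Qed.

Lemma hnormD x y : hnorm (x + y) <= hnorm x + hnorm y.
Proof. by rewrite /hnorm -scalar_reD; apply: ler_scalar_re; apply: ler_normD. Qed.

Lemma hnormZ (a : scalars R k) x : hnorm (a *: x) = re `|a| * hnorm x.
Proof. by rewrite /hnorm normrZ (scalar_normE a) scalar_reZ scalar_of_realK. Qed.

(** Cauchy-Schwarz, from the nonnegative squared norm of the component of [x] orthogonal to [y]. The
    case [y = 0] is split off because the projection divides by [hnorm y ^+ 2]. *)
Lemma ler_norm_rdot x y : `|rdot x y| <= hnorm x * hnorm y.
Proof.
have [/hnorm0_eq0 ->|y0] := eqVneq (hnorm y) 0.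
  by rewrite rdot0r hnorm0 mulr0 normr0.
have yp : 0 < hnorm y by rewrite lt_def y0 hnorm_ge0.
have : 0 <= rdot (x - (rdot x y / hnorm y ^+ 2)%:S *: y)
                 (x - (rdot x y / hnorm y ^+ 2)%:S *: y).
  by rewrite rdotxx sqr_ge0.
rewrite rdotBl !rdotBr !rdotZl !rdotZr !rdotxx (rdotC y x).
set d := rdot x y; move=> h.
rewrite -(ler_pXn2r (n := 2)) ?nnegrE ?mulr_ge0 ?hnorm_ge0//.
rewrite real_normK ?num_real// exprMn -ler_pdivrMr ?exprn_gt0//.
rewrite -subr_ge0; apply: le_trans h _; rewrite le_eqVlt; apply/orP; left; apply/eqP.
by field.
Qed.

Lemma rdot_eq x y : (forall z, rdot z x = rdot z y) -> x = y.
Proof.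
move=> xy; apply/eqP; rewrite -subr_eq0; apply/eqP/hnorm0_eq0/eqP.
by rewrite -sqrf_eq0 -rdotxx rdotBr xy subrr.
Qed.

Lemma parallelogram x y :
  hnorm (x - y) ^+ 2 + hnorm (x + y) ^+ 2 = 2 * hnorm x ^+ 2 + 2 * hnorm y ^+ 2.
Proof. by rewrite -!rdotxx rdotBl !rdotBr rdotDl !rdotDr; ring. Qed.

Lemma hilbert_cvgP (F : set_system V) (FF : Filter F) (l : V) :
  (F --> l) <-> (forall e : R, 0 < e -> \forall x \near F, hnorm (l - x) < e).
Proof.
split=> [/cvgrPdist_lt Fl e e0|Fl].
  have := Fl _ (scalar_of_real_gt0 k e0); apply: filterS => x.
  by rewrite hnormE ltr_scalar_of_real.
apply/cvgrPdist_lt => e /scalar_gt0[eE /Fl]; apply: filterS => x xe.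
by rewrite eE hnormE ltr_scalar_of_real.
Qed.

Lemma hilbert_cauchy_cvg (F : set_system V) (FF : ProperFilter F) :
  (forall e : R, 0 < e -> exists2 A, F A &
    forall x y, A x -> A y -> hnorm (x - y) < e) ->
  exists l : V, F --> l.
Proof.
move=> Fc; suff /cvg_ex[l Fl] : cvg F by exists l.
apply: cauchy_cvg; apply/cauchy_ballP => e /scalar_gt0[eE /Fc[A FA Ae]].
exists (A, A) => // -[x y] [/= Ax Ay]; rewrite -ball_normE /= hnormE eE.
by rewrite ltr_scalar_of_real; exact: Ae.
Qed.

End hilbert_geometry.

(** * Riesz representation of bounded real functionals *)

Section riesz.
Variables (R : realType) (k : scalar_kind) (V : hilbertType R k).
Implicit Types x y z : V.
Local Notation "r %:S" := (@scalar_of_real R k r) (at level 2, format "r %:S").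

(* The representing vector is the minimiser of [E x = |x|^2 - 2 f x]; by the
   parallelogram law the sets [E x < inf E + e] form a Cauchy filter. *)
Lemma real_riesz (f : V -> R) (C : R) :
  {morph f : x y / x + y} -> (forall r x, f (r%:S *: x) = r * f x) ->
  (forall x, `|f x| <= C * hnorm x) -> exists z, forall x, f x = rdot x z.
Proof.
move=> fD fZ fC.
pose E x := hnorm x ^+ 2 - 2 * f x.
have E_lb x : - (C ^+ 2) <= E x.
  have := fC x; rewrite ler_norml => /andP[_ fx].
  have := sqr_ge0 (hnorm x - C); rewrite /E; nra.
have infE : has_inf (range E).
  by split; [exists (E 0), 0 | exists (- (C ^+ 2)) => _ [x _ <-]].
pose m := inf (range E).
have mE x : m <= E x by apply: ge_inf; [exact: infE.2 | exists x].
have mA e : 0 < e -> exists x, E x < m + e.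
  by move=> /inf_adherent/(_ infE)[_ [x _ <-] xe]; exists x.
pose F := filter_from [set e : R | 0 < e] (fun e => [set x | E x < m + e]).
have FF : ProperFilter F.
  apply: filter_from_proper; last by move=> e /= /mA.
  apply: filter_from_filter; first by exists 1 => /=.
  move=> d e /= d0 e0; exists (Num.min d e); first by rewrite /= lt_min d0.
  move=> x /= xde; split => /=; apply: lt_le_trans xde _.
    by rewrite lerD2l ge_min lexx.
  by rewrite lerD2l ge_min lexx orbT.
(* Parallelogram law for [E]: at the midpoint the contributions of [f] cancel. *)
have Ediff x y : hnorm (x - y) ^+ 2 =
    2 * E x + 2 * E y - 4 * E (2^-1%:S *: (x + y)).
  rewrite /E -!rdotxx fZ fD rdotZl rdotZr rdotBl !rdotBr rdotDl !rdotDr.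
  by rewrite (rdotC y x); field.
have [e e0|z Fz] := @hilbert_cauchy_cvg _ _ V F FF.
  (* Since the midpoint value is at least [m], [Ediff] bounds the squared distance strictly by
     [4 * (m + e ^+ 2 / 4) - 4 * m = e ^+ 2]. *)
  exists [set x | E x < m + e ^+ 2 / 4].
    by exists (e ^+ 2 / 4) => //=; rewrite divr_gt0// exprn_gt0.
  move=> x y /= xe ye.
  rewrite -(ltr_pXn2r (n := 2)) ?nnegrE ?hnorm_ge0// ?ltW//.
  by rewrite Ediff; have := mE (2^-1%:S *: (x + y)); lra.
exists z => x.
have [x0|x0] := eqVneq (hnorm x) 0.
  rewrite (hnorm0_eq0 x0) rdot0l; apply/eqP; rewrite -normr_le0.
  by rewrite (le_trans (fC 0))// hnorm0 mulr0.
have xp : 0 < hnorm x by rewrite lt_def x0 hnorm_ge0.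
(* Stationarity is tested at a near-minimiser [w] close to [z]. Replacing [z] by [w] and the failure
   of [w] to be an exact minimiser cost [d * hnorm x] each. *)
have key d : 0 < d -> `|rdot x z - f x| <= 2 * d * hnorm x.
  move=> d0.
  have [w [Ew zw]] : exists w, E w < m + d ^+ 2 /\ hnorm (z - w) < d.
    have A1 : F [set w | E w < m + d ^+ 2].
      by exists (d ^+ 2) => //=; rewrite exprn_gt0.
    have A2 : F [set w | hnorm (z - w) < d].
      exact: (hilbert_cvgP (@filter_filter _ F FF) z).1.
    by have [w [? ?]] := filter_ex (filterI A1 A2); exists w.
  have q1 : `|rdot x (z - w)| <= d * hnorm x.
    rewrite (le_trans (ler_norm_rdot _ _))// mulrC ler_wpM2r ?hnorm_ge0//.
    exact: ltW.
  pose q := rdot x w - f x.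
  have q2 : `|q| <= d * hnorm x.
    rewrite -(ler_pXn2r (n := 2)) ?nnegrE ?mulr_ge0 ?hnorm_ge0 ?(ltW d0)//.
    rewrite real_normK ?num_real//.
    (* This coefficient minimises the quadratic [t -> E (w + t x)]. The drop it achieves is at most
       [d ^+ 2], because [E w] lies within [d ^+ 2] of the infimum. *)
    have Ewt : E (w + (- q / hnorm x ^+ 2)%:S *: x) = E w - q ^+ 2 / hnorm x ^+ 2.
      rewrite /E -!rdotxx fD fZ rdotDl !rdotDr !rdotZl !rdotZr !rdotxx.
      by rewrite (rdotC w x) /q; field.
    have h := mE (w + (- q / hnorm x ^+ 2)%:S *: x); rewrite Ewt in h.
    have qd : q ^+ 2 / hnorm x ^+ 2 <= d ^+ 2 by lra.
    by rewrite exprMn -ler_pdivrMr ?exprn_gt0.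
  have -> : rdot x z - f x = rdot x (z - w) + q by rewrite /q rdotBr; ring.
  by rewrite (le_trans (ler_normD _ _))//; lra.
apply/esym/eqP; rewrite -subr_eq0 -normr_le0; apply/ler_addgt0Pr => e e0.
rewrite add0r (le_trans (key (e / (2 * hnorm x)) _)) ?divr_gt0 ?mulr_gt0//.
rewrite le_eqVlt; apply/orP; left; apply/eqP.
by field.
Qed.

End riesz.

(** * Bounded operators and their adjoints *)

Section bounded_linear.
Variables (R : realType) (k : scalar_kind).
Implicit Types V W Z : hilbertType R k.

Lemma hdotZr V a (x y : V) : hdot x (a *: y) = scalar_conj a * hdot x y.
Proof. exact: (linearZr_LR (@hdot R k V)). Qed.

Lemma hdotDr V (x y z : V) : hdot x (y + z) = hdot x y + hdot x z.
Proof. exact: (linearDr (@hdot R k V)). Qed.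

Lemma hdot_eq V (x y : V) : (forall z, hdot z x = hdot z y) -> x = y.
Proof. by move=> xy; apply: rdot_eq => z; rewrite /rdot xy. Qed.

Lemma bounded_linearD V W (f : V -> W) : bounded_linear f ->
  {morph f : x y / x + y}.
Proof. by move=> [fl _] x y; have := fl 1 x y; rewrite !scale1r. Qed.

Lemma bounded_linear0 V W (f : V -> W) : bounded_linear f -> f 0 = 0.
Proof.
by move=> /bounded_linearD fD; apply: (addrI (f 0)); rewrite -fD !addr0.
Qed.

Lemma bounded_linearZ V W (f : V -> W) : bounded_linear f ->
  forall a x, f (a *: x) = a *: f x.
Proof.
move=> fl a x; have := fl.1 a x 0.
by rewrite !addr0 (bounded_linear0 fl) addr0.
Qed.

Lemma bounded_linearB V W (f : V -> W) : bounded_linear f ->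
  {morph f : x y / x - y}.
Proof.
move=> fl x y; rewrite (bounded_linearD fl) -scaleN1r (bounded_linearZ fl).
by rewrite scaleN1r.
Qed.

Lemma bounded_linear_sum V W (f : V -> W) (I : Type) (s : seq I) (x : I -> V) :
  bounded_linear f -> f (\sum_(i <- s) x i) = \sum_(i <- s) f (x i).
Proof.
move=> fl; apply: (big_morph f (bounded_linearD fl)); exact: bounded_linear0.
Qed.

Lemma bounded_linear_bound V W (f : V -> W) : bounded_linear f ->
  exists2 C, 0 < C & forall x, hnorm (f x) <= C * hnorm x.
Proof.
move=> [_ [C fC]]; exists (Num.max C 1); first by rewrite lt_max ltr01 orbT.
move=> x; rewrite (le_trans (fC x))// ler_wpM2r ?hnorm_ge0//.
by rewrite le_max lexx.
Qed.

Lemma bounded_linear_comp V W Z (f : W -> Z) (g : V -> W) :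
  bounded_linear f -> bounded_linear g -> bounded_linear (f \o g).
Proof.
move=> fl gl; split=> [a x y /=|]; first by rewrite gl.1 fl.1.
have [C C0 fC] := bounded_linear_bound fl.
have [D D0 gD] := bounded_linear_bound gl.
exists (C * D) => x /=; rewrite (le_trans (fC _))// -mulrA.
by rewrite ler_pM2l.
Qed.

Lemma bounded_linear_add V W (f g : V -> W) :
  bounded_linear f -> bounded_linear g -> bounded_linear (fun x => f x + g x).
Proof.
move=> fl gl; split=> [a x y|]; first by rewrite fl.1 gl.1 scalerDr addrACA.
have [C C0 fC] := bounded_linear_bound fl.
have [D D0 gD] := bounded_linear_bound gl.
by exists (C + D) => x; rewrite (le_trans (hnormD _ _))// mulrDl lerD.
Qed.

(** Riesz represents only the real part of [hdot (f x) y]; replacing [x] by its scalar multiples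
    recovers the full inner product. Hence the set in [adjoint] is inhabited and [xget] does not
    return its default. *)
Lemma adjointP V W (f : V -> W) : bounded_linear f ->
  forall x y, hdot (f x) y = hdot x (adjoint f y).
Proof.
move=> fl x0 y; pose P z := forall x, hdot (f x) y = hdot x z.
suff [z Pz] : exists z, P z.
  by have := @xgetPex _ 0 P; move=> /(_ (ex_intro _ z Pz))/(_ x0).
have [C C0 fC] := bounded_linear_bound fl.
have [] := @real_riesz R k V (fun x => rdot (f x) y) (C * hnorm y).
- by move=> x x'; rewrite (bounded_linearD fl) rdotDl.
- by move=> r x; rewrite (bounded_linearZ fl) rdotZl.
- move=> x; rewrite (le_trans (ler_norm_rdot _ _))// mulrAC.
  by rewrite ler_wpM2r ?hnorm_ge0.
move=> z fz; exists z => x; apply/eqP; rewrite -subr_eq0; apply/eqP.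
apply: scalar_re_eq0 => a.
rewrite mulrBr -!hdotZl scalar_reB -(bounded_linearZ fl).
by rewrite [scalar_re _]fz subrr.
Qed.

Lemma adjoint_unique V W (f : V -> W) (g : W -> V) : bounded_linear f ->
  (forall x y, hdot (f x) y = hdot x (g y)) -> adjoint f = g.
Proof.
move=> fl fg; apply/funext => y; apply: hdot_eq => x.
by rewrite -adjointP// fg.
Qed.

(** With [z = adjoint f y], moving [f] across gives [hnorm z ^+ 2 = rdot (f z) y <= C * hnorm z *
    hnorm y], and [hnorm z] cancels. *)
Lemma hnorm_adjoint V W (f : V -> W) (C : R) : bounded_linear f -> 0 <= C ->
  (forall x, hnorm (f x) <= C * hnorm x) ->
  forall y, hnorm (adjoint f y) <= C * hnorm y.
Proof.
move=> fl C0 fC y; set z := adjoint f y.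
have [->|z0] := eqVneq (hnorm z) 0; first by rewrite mulr_ge0 ?hnorm_ge0.
have zp : 0 < hnorm z by rewrite lt_def z0 hnorm_ge0.
rewrite -(ler_pM2l zp) -expr2 -rdotxx {2}/z /rdot -adjointP// -/(rdot _ _).
rewrite (le_trans (ler_norm _))// (le_trans (ler_norm_rdot _ _))//.
by rewrite mulrA ler_wpM2r ?hnorm_ge0// mulrC.
Qed.

Lemma bounded_linear_adjoint V W (f : V -> W) :
  bounded_linear f -> bounded_linear (adjoint f).
Proof.
move=> fl; split=> [a x y|].
  by apply: hdot_eq => z; rewrite -adjointP// !hdotDr !hdotZr -!adjointP.
have [C C0 fC] := bounded_linear_bound fl.
by exists C; apply: hnorm_adjoint => //; exact: ltW.
Qed.

Lemma hdot_adjointl V W (f : V -> W) : bounded_linear f ->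
  forall x y, hdot (adjoint f y) x = hdot y (f x).
Proof. by move=> fl x y; rewrite hdotC -adjointP// -hdotC. Qed.

Lemma adjointK V W (f : V -> W) : bounded_linear f -> adjoint (adjoint f) = f.
Proof.
move=> fl; apply: adjoint_unique; first exact: bounded_linear_adjoint.
by move=> x y; exact: hdot_adjointl.
Qed.

Lemma rdot_adjoint V W (f : V -> W) : bounded_linear f ->
  forall x y, rdot (f x) y = rdot x (adjoint f y).
Proof. by move=> fl x y; rewrite /rdot adjointP. Qed.

(** Scaling [y] by [a = hdot x y] turns the product into the real number [|a|^2], to which the real
    Cauchy-Schwarz inequality applies. *)
Lemma ler_norm_hdot V (x y : V) : scalar_re `|hdot x y| <= hnorm x * hnorm y.
Proof.
set a := hdot x y; set t := scalar_re `|a|.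
have [->|t0] := eqVneq t 0; first by rewrite mulr_ge0 ?hnorm_ge0.
have tp : 0 < t by rewrite lt_def t0 scalar_re_norm_ge0.
have := le_trans (ler_norm _) (ler_norm_rdot x (a *: y)).
rewrite /rdot hdotZr -/a scalar_re_conjM hnormZ -/t expr2 mulrCA.
by rewrite ler_pM2l.
Qed.

Lemma bounded_linear_rank1 V W (h : V) (z : W) :
  bounded_linear (fun x : V => hdot x h *: z).
Proof.
split=> [a x y|]; first by rewrite hdotDl hdotZl scalerDl scalerA.
exists (hnorm h * hnorm z) => x; rewrite hnormZ.
by rewrite [leRHS]mulrC mulrA ler_wpM2r ?hnorm_ge0// ler_norm_hdot.
Qed.

End bounded_linear.

(** * Unconditional sums in a Hilbert space *)

Lemma big_fset_setD (T : choiceType) (V : zmodType) (x : T -> V) (A B : {fset T}) :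
  (A `<=` B)%fset ->
  \sum_(i <- B) x i = \sum_(i <- A) x i + \sum_(i <- (B `\` A)%fset) x i.
Proof.
move=> AB; rewrite (big_fsetID _ (mem A)); congr (_ + _); apply: congr_big => //.
  congr enum_fset; apply/fsetP => i; rewrite !inE/=.
  by case: (boolP (i \in A)) => [/(fsubsetP AB) ->|_] //; rewrite andbF.
by congr enum_fset; apply/fsetP => i; rewrite !inE/= andbC.
Qed.

Section has_sum.
Variables (R : realType) (k : scalar_kind) (T : choiceType).
Implicit Types V W : hilbertType R k.

Definition has_sum V (x : T -> V) (l : V) : Prop :=
  forall e : R, 0 < e -> exists A : {fset T}, forall B : {fset T},
    (A `<=` B)%fset -> hnorm (l - \sum_(i <- B) x i) < e.

Lemma has_sumE V (x : T -> V) (l : V) : has_sum x l -> sum x = l.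
Proof.
move=> xl; apply: cvg_lim; first exact: norm_hausdorff.
  exact: fmap_proper_filter (@totally_filter T).
have TF : Filter (@totally T) := @filter_filter _ _ totally_filter.
apply/(hilbert_cvgP (fmap_filter (partial_sum x) TF)) => e /xl[A Ae].
by exists A => // B AB; have := Ae _ AB; rewrite big_seq_fsetE.
Qed.

Lemma has_sum_linear V W (f : V -> W) (x : T -> V) (l : V) :
  bounded_linear f -> has_sum x l -> has_sum (f \o x) (f l).
Proof.
move=> fl xl e e0; have [C C0 fC] := bounded_linear_bound fl.
have [A Ae] := xl (e / C) (divr_gt0 e0 C0).
exists A => B /Ae; rewrite ltr_pdivlMr// mulrC => Be.
rewrite /= -bounded_linear_sum// -bounded_linearB//.
exact: le_lt_trans (fC _) Be.
Qed.

Lemma has_sumD V (x y : T -> V) (l m : V) :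
  has_sum x l -> has_sum y m -> has_sum (fun i => x i + y i) (l + m).
Proof.
move=> xl ym e e0; have e2 : 0 < e / 2 by rewrite divr_gt0.
have [A Ae] := xl _ e2; have [B Be] := ym _ e2.
exists (A `|` B)%fset => C; rewrite fsubUset => /andP[/Ae lC /Be mC].
rewrite big_split opprD addrACA (splitr e).
by rewrite (le_lt_trans (hnormD _ _))// ltrD.
Qed.

Lemma has_sum_fin V (x : T -> V) (A : {fset T}) :
  (forall i, i \notin A -> x i = 0) -> has_sum x (\sum_(i <- A) x i).
Proof.
move=> xA e e0; exists A => B AB.
by rewrite (big_fset_incl _ AB) ?subrr ?hnorm0// => i _ /xA.
Qed.

Lemma has_sum_ler V (x : T -> V) (l : V) (M : R) : has_sum x l ->
  (forall A : {fset T}, hnorm (\sum_(i <- A) x i) <= M) -> hnorm l <= M.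
Proof.
move=> xl xM; apply/ler_addgt0Pr => e /xl[A /(_ A (fsubset_refl _)) Ae].
rewrite -[l](subrK (\sum_(i <- A) x i)) (le_trans (hnormD _ _))//.
by rewrite addrC lerD// ltW.
Qed.

Lemma hilbert_has_sum V (x : T -> V) :
  (forall e : R, 0 < e -> exists A : {fset T}, forall B : {fset T},
     [disjoint A & B]%fset -> hnorm (\sum_(i <- B) x i) < e) ->
  exists l, has_sum x l.
Proof.
move=> xc; pose F := (fun B : {fset T} => \sum_(i <- B) x i) @ totally.
have TF : ProperFilter (@totally T) := totally_filter.
have FF : ProperFilter F by exact: fmap_proper_filter.
have [e e0|l Fl] := @hilbert_cauchy_cvg _ _ V F FF.
  (* The sums over two supersets of [A] differ by two sums over sets disjoint from [A], each below
     [e / 2]. *)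
  have [A Ae] := xc (e / 2) (divr_gt0 e0 (ltr0n _ 2)).
  exists [set \sum_(i <- B) x i | B in [set B : {fset T} | (A `<=` B)%fset]].
    by exists A => // B AB; exists B.
  move=> _ _ [B /= AB <-] [C /= AC <-].
  rewrite (big_fset_setD _ AB) (big_fset_setD _ AC).
  rewrite opprD addrACA subrr add0r (splitr e).
  rewrite (le_lt_trans (hnormD _ _))// hnormN ltrD// Ae//.
    by apply/fdisjointP => i iA; rewrite inE iA.
  by apply/fdisjointP => i iA; rewrite inE iA.
exists l => e e0.
have [A _ Ae] := (hilbert_cvgP (@filter_filter _ _ FF) l).1 Fl e e0.
by exists A => B /Ae.
Qed.

End has_sum.

(** * Square-summable sequences *)

Section square_summable.
Variables (R : realType) (k : scalar_kind) (K : hilbertType R k).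
Variables (I : set int) (K_ : I -> closed_subspace K).
Implicit Types x y : forall i, K_ i.

(** The finite-subset form keeps estimates in [R], away from extended reals. *)
Definition sqr_sum_bound x (M : R) : Prop :=
  forall A : {fset I}, \sum_(i <- A) hnorm (x i) ^+ 2 <= M.

Lemma sqr_sum_boundP x M : (sqr_sum x <= M%:E)%E <-> sqr_sum_bound x M.
Proof.
split=> [xM A|xM].
  rewrite -lee_fin; apply: le_trans xM; apply: esum_ge.
  exists [set` A]; first by split.
  by rewrite fsbig_finite//= set_fsetK sumEFin.
apply: ge_ereal_sup => _ [A [finA _] <-].
by rewrite fsbig_finite//= sumEFin lee_fin.
Qed.

Lemma sqr_sum_ge0 x : (0 <= sqr_sum x)%E.
Proof. by apply: esum_ge0 => i _; rewrite lee_fin sqr_ge0. Qed.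

Lemma l2_bound x M : sqr_sum_bound x M -> l2 x.
Proof. by move=> /sqr_sum_boundP xM; apply: le_lt_trans xM (ltry _). Qed.

Lemma l2_norm_bound x : l2 x -> sqr_sum_bound x (l2_norm x ^+ 2).
Proof.
move=> xl; apply/sqr_sum_boundP; rewrite sqr_sqrtr ?fine_ge0 ?sqr_sum_ge0//.
by rewrite fineK// ge0_fin_numE ?sqr_sum_ge0.
Qed.

Lemma l2_norm_ler x M : 0 <= M -> sqr_sum_bound x (M ^+ 2) -> l2_norm x <= M.
Proof.
move=> M0 xM; have xl := l2_bound xM; move/sqr_sum_boundP : xM => xM.
rewrite -[leRHS]ger0_norm// -sqrtr_sqr ler_sqrt ?sqr_ge0//.
by rewrite -lee_fin fineK// ge0_fin_numE ?sqr_sum_ge0.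
Qed.

Lemma sqr_sum_boundZ x y (C M : R) : 0 <= C ->
  (forall i, hnorm (y i) <= C * hnorm (x i)) ->
  sqr_sum_bound x M -> sqr_sum_bound y (C ^+ 2 * M).
Proof.
move=> C0 yx xM A; apply: le_trans (_ : \sum_(i <- A) C ^+ 2 * hnorm (x i) ^+ 2 <= _).
  apply: ler_sum => i _; rewrite -exprMn.
  by rewrite ler_pXn2r ?nnegrE ?mulr_ge0 ?hnorm_ge0.
by rewrite -mulr_sumr ler_wpM2l ?sqr_ge0.
Qed.

Lemma sqr_sum_boundD x y M N : sqr_sum_bound x M -> sqr_sum_bound y N ->
  sqr_sum_bound (fun i => x i + y i) (2 * (M + N)).
Proof.
move=> xM yN A.
apply: le_trans (_ : \sum_(i <- A) (2 * hnorm (x i) ^+ 2 + 2 * hnorm (y i) ^+ 2) <= _).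
  by apply: ler_sum => i _; rewrite -parallelogram lerDr sqr_ge0.
by rewrite big_split /= -!mulr_sumr -mulrDr ler_pM2l// lerD.
Qed.

(** Take [A] whose sum is within [e] of the supremum of all finite sums: a disjoint [B] contributing
    [e] or more would push the sum over the union above that supremum. *)
Lemma sqr_sum_tail x : l2 x -> forall e : R, 0 < e -> exists A : {fset I},
  forall B : {fset I}, [disjoint A & B]%fset -> \sum_(i <- B) hnorm (x i) ^+ 2 < e.
Proof.
move=> /l2_norm_bound xM e e0.
pose S := [set \sum_(i <- A) hnorm (x i) ^+ 2 | A in [set: {fset I}]].
have supS : has_sup S.
  split; first by exists (\sum_(i <- fset0%fset) hnorm (x i) ^+ 2), fset0%fset.
  by exists (l2_norm x ^+ 2) => _ [A _ <-].
have [_ [A _ <-] Ae] := sup_adherent e0 supS.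
exists A => B AB.
have : \sum_(i <- (A `|` B)%fset) hnorm (x i) ^+ 2 <= sup S.
  by apply: ub_le_sup; [exact: supS.2 | exists (A `|` B)%fset].
rewrite (big_fset_setD _ (fsubsetUl A B)).
have -> : ((A `|` B) `\` A)%fset = B.
  by rewrite fsetDUl fsetDv fset0U; apply/fsetDidPl; rewrite fdisjoint_sym.
lra.
Qed.

End square_summable.

(** * Inverses of bijections *)

Section inverse.
Variables (R : realType) (k : scalar_kind) (V W : hilbertType R k).

Lemma inverseKV (f : V -> W) : bijective f -> cancel f (inverse f).
Proof.
by move=> /bij_inj fi x; apply: pinvKV; rewrite ?inE// => y z _ _; exact: fi.
Qed.

Lemma inverseK (f : V -> W) : bijective f -> cancel (inverse f) f.
Proof. by move=> [g gK fK] y; apply: pinvK; rewrite inE; exists (g y). Qed.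

End inverse.

(** * Pairing unconditional sums with vectors *)

Section has_sum_rdot.
Variables (R : realType) (k : scalar_kind) (T : choiceType).

Lemma rdot_suml (V : hilbertType R k) (s : seq T) (x : T -> V) (z : V) :
  rdot (\sum_(i <- s) x i) z = \sum_(i <- s) rdot (x i) z.
Proof.
apply: (big_morph (fun v => rdot v z)) => [v w|]; first by rewrite rdotDl.
by rewrite rdot0l.
Qed.

Lemma rdot_sumr (V : hilbertType R k) (s : seq T) (x : T -> V) (z : V) :
  rdot z (\sum_(i <- s) x i) = \sum_(i <- s) rdot z (x i).
Proof.
by rewrite rdotC rdot_suml; apply: eq_bigr => i _; rewrite rdotC.
Qed.

(** Both limits are compared with partial sums over one finite set [D] past both tails, where the
    pairings agree term by term. *)
Lemma has_sum_rdot (V W : hilbertType R k) (x : T -> V) (y : T -> W)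
    (l z : V) (m w : W) :
  has_sum x l -> has_sum y m -> (forall i, rdot (x i) z = rdot w (y i)) ->
  rdot l z = rdot w m.
Proof.
move=> xl ym xy; apply/eqP; rewrite -subr_eq0 -normr_le0.
apply/ler_addgt0Pr => e e0; rewrite add0r.
(* The [+ 1] keeps [C] positive when [z] and [w] both vanish. *)
pose C := hnorm z + hnorm w + 1.
have C0 : 0 < C by rewrite ltr_wpDl ?addr_ge0 ?hnorm_ge0.
have [A Ae] := xl _ (divr_gt0 e0 C0); have [B Be] := ym _ (divr_gt0 e0 C0).
have {}Ae := Ae _ (fsubsetUl A B); have {}Be := Be _ (fsubsetUr A B).
set D := (A `|` B)%fset in Ae Be.
have xyD : rdot (\sum_(i <- D) x i) z = rdot w (\sum_(i <- D) y i).
  by rewrite rdot_suml rdot_sumr; apply: eq_bigr => i _.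
have -> : rdot l z - rdot w m =
    rdot (l - \sum_(i <- D) x i) z - rdot w (m - \sum_(i <- D) y i).
  by rewrite rdotBl rdotBr xyD; ring.
apply: le_trans (ler_normB _ _) _.
apply: le_trans (lerD (ler_norm_rdot _ _) (ler_norm_rdot _ _)) _.
have -> : e = e / C * hnorm z + e / C * hnorm w + e / C.
  by rewrite /C; field; rewrite -/C gt_eqF.
have zl : hnorm (l - \sum_(i <- D) x i) * hnorm z <= e / C * hnorm z.
  by rewrite ler_wpM2r ?hnorm_ge0// ltW.
have wm : hnorm w * hnorm (m - \sum_(i <- D) y i) <= e / C * hnorm w.
  by rewrite mulrC ler_wpM2r ?hnorm_ge0// ltW.
by have := divr_gt0 e0 C0; lra.
Qed.

End has_sum_rdot.

(** * g-Bessel sequences: synthesis, analysis and duality *)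

Section bessel.
Variables (R : realType) (k : scalar_kind) (H K : hilbertType R k).
Variables (I : set int) (K_ : I -> closed_subspace K).
Implicit Types (L G : forall i : I, H -> K_ i) (y : forall i : I, K_ i).

Definition bessel L (B : R) : Prop :=
  [/\ forall i, bounded_linear (L i), 0 < B &
      forall x, sqr_sum_bound (analysis_op L x) (B * hnorm x ^+ 2)].

Lemma gframe_bessel L : gframe L -> exists B, bessel L B.
Proof.
move=> [Ll [A [B [A0 B0 LAB]]]]; exists B; split => // x.
by apply/sqr_sum_boundP; case/andP: (LAB x).
Qed.

(** The [+ 1] keeps the bound positive when [a] or [b] is zero. *)
Lemma bessel_comp L B (v : forall i : I, K_ i -> K_ i) (f : H -> H) a b :
  bessel L B -> (forall i, bounded_linear (v i)) -> bounded_linear f ->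
  0 <= a -> 0 <= b -> (forall i z, hnorm (v i z) <= a * hnorm z) ->
  (forall x, hnorm (f x) <= b * hnorm x) ->
  bessel (fun i => v i \o L i \o f) (a ^+ 2 * (B * b ^+ 2) + 1).
Proof.
move=> [Ll B0 LB] vl fl a0 b0 va fb.
have ab0 : 0 <= a ^+ 2 * (B * b ^+ 2).
  by rewrite mulr_ge0 ?sqr_ge0// mulr_ge0 ?sqr_ge0// ltW.
split=> [i||x A]; first by do 2!apply: bounded_linear_comp => //.
  by rewrite ltr_wpDl.
apply: le_trans (sqr_sum_boundZ a0 (fun i => va i (L i (f x))) (LB _) A) _.
have fx : hnorm (f x) ^+ 2 <= b ^+ 2 * hnorm x ^+ 2.
  by rewrite -exprMn ler_pXn2r ?nnegrE ?mulr_ge0 ?hnorm_ge0.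
apply: le_trans (_ : a ^+ 2 * (B * (b ^+ 2 * hnorm x ^+ 2)) <= _).
  by rewrite ler_wpM2l ?sqr_ge0// ler_pM2l.
have := sqr_ge0 (hnorm x); lra.
Qed.

(** Source of competing duals: if [y] is in the kernel of a synthesis operator, this perturbation of
    a dual is still a dual. *)
Lemma bessel_add_rank1 L B (h : H) y : bessel L B -> l2 y ->
  exists C, bessel (fun i x => L i x + hdot x h *: y i) C.
Proof.
move=> [Ll B0 LB] yl; set M := l2_norm y ^+ 2.
have hM : 0 <= hnorm h ^+ 2 * M by rewrite mulr_ge0 ?sqr_ge0.
exists (2 * (B + hnorm h ^+ 2 * M)); split=> [i||x A].
- exact: bounded_linear_add (Ll i) (bounded_linear_rank1 h (y i)).
- by rewrite mulr_gt0// ltr_wpDr.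
have hy : sqr_sum_bound (fun i => hdot x h *: y i : K_ i)
    ((hnorm x * hnorm h) ^+ 2 * M).
  apply: (sqr_sum_boundZ _ _ (l2_norm_bound yl)).
    by rewrite mulr_ge0 ?hnorm_ge0.
  by move=> i; rewrite hnormZ ler_wpM2r ?hnorm_ge0// ler_norm_hdot.
apply: le_trans (sqr_sum_boundD (LB x) hy A) _.
by rewrite le_eqVlt; apply/orP; left; apply/eqP; ring.
Qed.

(* AM-GM: [2 <L_i s, y_i> <= |L_i s|^2 / B + B |y_i|^2], where
   [s] is the left-hand sum. *)
Lemma bessel_synthesis_fin L B (y : forall i : I, K_ i) (A : {fset I}) :
  bessel L B ->
  hnorm (\sum_(i <- A) adjoint (L i) (y i)) ^+ 2 <=
    B * \sum_(i <- A) hnorm (y i) ^+ 2.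
Proof.
move=> [Ll B0 LB]; set s := \sum_(i <- A) _.
have s2 : hnorm s ^+ 2 = \sum_(i <- A) rdot (L i s) (y i).
  rewrite -rdotxx {2}/s rdot_sumr; apply: eq_bigr => i _.
  by rewrite rdot_adjoint.
have : 2 * hnorm s ^+ 2 <=
    B^-1 * \sum_(i <- A) hnorm (L i s) ^+ 2 + B * \sum_(i <- A) hnorm (y i) ^+ 2.
  rewrite s2 !mulr_sumr -big_split; apply: ler_sum => i _ /=.
  have := ler_norm_rdot (L i s) (y i); rewrite ler_norml => /andP[_ h].
  apply: le_trans (_ : 2 * (hnorm (L i s) * hnorm (y i)) <= _).
    by rewrite ler_pM2l.
  have : 0 <= B^-1 * (hnorm (L i s) - B * hnorm (y i)) ^+ 2.
    by rewrite mulr_ge0 ?sqr_ge0// invr_ge0 ltW.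
  have -> : B^-1 * (hnorm (L i s) - B * hnorm (y i)) ^+ 2 =
    B^-1 * hnorm (L i s) ^+ 2 + B * hnorm (y i) ^+ 2
      - 2 * (hnorm (L i s) * hnorm (y i)) by field; rewrite gt_eqF.
  by rewrite subr_ge0.
(* The Bessel bound at [s] lets this term be absorbed into [2 * hnorm s ^+ 2]. *)
have : B^-1 * \sum_(i <- A) hnorm (L i s) ^+ 2 <= hnorm s ^+ 2.
  by rewrite ler_pdivrMl//; exact: LB.
lra.
Qed.

Lemma has_sum_synthesis L B y : bessel L B -> l2 y ->
  has_sum (fun i => adjoint (L i) (y i)) (synthesis_op L y).
Proof.
move=> LB yl; have [_ B0 _] := LB.
have [e e0|l yl'] := @hilbert_has_sum _ _ _ H (fun i => adjoint (L i) (y i)).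
  (* By [bessel_synthesis_fin], a tail below [e ^+ 2 / B] yields a vector of norm below [e]. *)
  have [A Ae] := sqr_sum_tail yl (divr_gt0 (exprn_gt0 2 e0) B0).
  exists A => D /Ae De.
  rewrite -(ltr_pXn2r (n := 2)) ?nnegrE ?hnorm_ge0 ?(ltW e0)//.
  by rewrite (le_lt_trans (bessel_synthesis_fin _ _ LB))// mulrC -ltr_pdivlMr.
by rewrite /synthesis_op (has_sumE yl').
Qed.

Lemma hnorm_synthesis L B y M : bessel L B -> sqr_sum_bound y M ->
  hnorm (synthesis_op L y) ^+ 2 <= B * M.
Proof.
move=> LB yM; have [_ B0 _] := LB.
have M0 : 0 <= M by have := yM fset0; rewrite big_seq_fset0.
have BM0 : 0 <= B * M by rewrite mulr_ge0// ltW.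
rewrite -(sqr_sqrtr BM0) ler_pXn2r ?nnegrE ?hnorm_ge0 ?sqrtr_ge0//.
apply: has_sum_ler (has_sum_synthesis LB (l2_bound yM)) _ => A.
rewrite -(ler_pXn2r (n := 2)) ?nnegrE ?hnorm_ge0 ?sqrtr_ge0// sqr_sqrtr//.
by rewrite (le_trans (bessel_synthesis_fin _ _ LB))// ler_pM2l.
Qed.

Lemma synthesisD L B y y' : bessel L B -> l2 y -> l2 y' ->
  synthesis_op L (fun i => y i + y' i) = synthesis_op L y + synthesis_op L y'.
Proof.
move=> LB yl yl'; apply: has_sumE.
have := has_sumD (has_sum_synthesis LB yl) (has_sum_synthesis LB yl').
have [Ll _ _] := LB; congr has_sum; apply/funext => i.
by rewrite (bounded_linearD (bounded_linear_adjoint (Ll i))).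
Qed.

Lemma bounded_linear_scale (V : hilbertType R k) (a : scalars R k) :
  bounded_linear ( *:%R a : V -> V).
Proof.
split=> [b x y|]; first by rewrite scalerDr !scalerA mulrC.
by exists (scalar_re `|a|) => x; rewrite hnormZ.
Qed.

Lemma l2Z a y : l2 y -> l2 (fun i => a *: y i : K_ i).
Proof.
move=> yl.
apply: (l2_bound (sqr_sum_boundZ (scalar_re_norm_ge0 a) _ (l2_norm_bound yl))).
by move=> i; rewrite hnormZ.
Qed.

Lemma l2D y y' : l2 y -> l2 y' -> l2 (fun i => y i + y' i : K_ i).
Proof.
move=> yl yl'.
exact: l2_bound (sqr_sum_boundD (l2_norm_bound yl) (l2_norm_bound yl')).
Qed.

Lemma synthesisZ L B a y : bessel L B -> l2 y ->
  synthesis_op L (fun i => a *: y i) = a *: synthesis_op L y.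
Proof.
move=> LB yl; apply: has_sumE.
have := has_sum_linear (bounded_linear_scale H a) (has_sum_synthesis LB yl).
have [Ll _ _] := LB; congr has_sum; apply/funext => i /=.
by rewrite (bounded_linearZ (bounded_linear_adjoint (Ll i))).
Qed.

Lemma synthesis_comp L L' B B' (f : H -> H) (v : forall i, K_ i -> K_ i) y :
  bessel L B -> bessel L' B' -> bounded_linear f ->
  (forall i z, adjoint (L' i) z = f (adjoint (L i) (v i z))) ->
  l2 (diag v y) ->
  synthesis_op L' y = f (synthesis_op L (diag v y)).
Proof.
move=> LB LB' fl L'E yl; apply: has_sumE.
have := has_sum_linear fl (has_sum_synthesis LB yl).
by congr has_sum; apply/funext => i; rewrite L'E.
Qed.

Lemma analysis_l2 L B x : bessel L B -> l2 (analysis_op L x).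
Proof. by move=> [_ _ LB]; exact: l2_bound (LB x). Qed.

(** The lower frame bound of [G] comes from reconstruction: [x] is the synthesis by [L] of its
    [G]-coefficients, so [hnorm x ^+ 2] is at most [B] times their squared norm. *)
Lemma dual_gframe_bessel L G B C : bessel L B -> bessel G C ->
  (forall x, synthesis_op L (analysis_op G x) = x) -> dual_gframe L G.
Proof.
move=> LB GC LG; split=> //; have [Gl C0 GC'] := GC; split=> //.
have [_ B0 _] := LB.
exists B^-1, C; split; rewrite ?invr_gt0// => x; apply/andP; split; last first.
  exact/sqr_sum_boundP.
have xl := analysis_l2 x GC.
have -> : sqr_sum (analysis_op G x) = (l2_norm (analysis_op G x) ^+ 2)%:E.
  rewrite sqr_sqrtr ?fine_ge0 ?sqr_sum_ge0//.
  by rewrite fineK// ge0_fin_numE ?sqr_sum_ge0.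
rewrite lee_fin ler_pdivrMl// -{1}[x]LG.
exact: hnorm_synthesis LB (l2_norm_bound xl).
Qed.

(** Duality is symmetric: take adjoints in $T_L T_G^* = Id$, done here term by term on the
    series. *)
Lemma synthesis_analysis_swap L G B C : bessel L B -> bessel G C ->
  (forall x, synthesis_op L (analysis_op G x) = x) ->
  forall x, synthesis_op G (analysis_op L x) = x.
Proof.
move=> LB GC LG x; apply: rdot_eq => z; rewrite -[in RHS](LG z); apply/esym.
apply: has_sum_rdot (has_sum_synthesis LB (analysis_l2 z GC))
  (has_sum_synthesis GC (analysis_l2 x LB)) _ => i.
have [Ll _ _] := LB; have [Gl _ _] := GC.
by rewrite -(rdot_adjoint (Gl i)) rdotC -(rdot_adjoint (Ll i)) rdotC.
Qed.

End bessel.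

(** * Sequences supported at one index *)

Section delta.
Variables (R : realType) (k : scalar_kind) (H K : hilbertType R k).
Variables (I : set int) (K_ : I -> closed_subspace K).
Implicit Types u : forall i : I, K_ i -> K_ i.

(** The type [K_ j] varies with [j], hence a dependent update of the zero sequence. *)
Definition delta (i : I) (v : K_ i) : forall j : I, K_ j :=
  @eqtype.dfwith I (fun j => K_ j) (fun=> 0) i v.

Lemma sqr_sum_bound_delta i (v : K_ i) : sqr_sum_bound (delta v) (hnorm v ^+ 2).
Proof.
move=> A; have Z (B : {fset I}) : i \notin B ->
    \sum_(j <- B) hnorm (delta v j) ^+ 2 = 0.
  move=> iB; rewrite big_seq big1// => j jB; rewrite /delta dfwith_out.
    by rewrite hnorm0 expr0n.
  by apply: contraNneq iB => ->.
have [iA|iA] := boolP (i \in A); last by rewrite Z// sqr_ge0.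
by rewrite (big_fsetD1 i)//= Z ?addr0 /delta ?dfwith_in// !inE eqxx.
Qed.

(** Testing the diagonal operator on [delta v] makes its bound uniform over the blocks. The maximum
    with 0 is taken because [C] may be negative. *)
Lemma diag_bound u : (forall i, bounded_linear (u i)) -> l2_bounded (diag u) ->
  exists2 C, 0 <= C & forall i v, hnorm (u i v) <= C * hnorm v.
Proof.
move=> ul [C uC]; exists (Num.max C 0); first by rewrite le_max lexx orbT.
move=> i v; have dv := sqr_sum_bound_delta v.
have [udl udC] := uC _ (l2_bound dv).
have dn : l2_norm (delta v) <= hnorm v by exact: l2_norm_ler (hnorm_ge0 v) dv.
apply: le_trans (_ : l2_norm (diag u (delta v)) <= _).
  rewrite -(ler_pXn2r (n := 2)) ?nnegrE ?hnorm_ge0 ?sqrtr_ge0//.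
  have := l2_norm_bound udl [fset i]%fset.
  by rewrite big_seq_fset1 /diag /delta dfwith_in.
rewrite (le_trans udC)//.
apply: le_trans (_ : Num.max C 0 * l2_norm (delta v) <= _).
  by rewrite ler_wpM2r ?sqrtr_ge0// le_max lexx.
by rewrite ler_wpM2l// le_max lexx orbT.
Qed.

(** This reads the individual operators off the synthesis operator, so equal synthesis operators
    force equal sequences. *)
Lemma synthesis_delta (L : forall i : I, H -> K_ i) i (v : K_ i) :
  (forall i, bounded_linear (L i)) ->
  synthesis_op L (delta v) = adjoint (L i) v.
Proof.
move=> Ll; apply: has_sumE.
have := @has_sum_fin _ _ _ H (fun j => adjoint (L j) (delta v j)) [fset i]%fset.
rewrite big_seq_fset1 /delta dfwith_in; apply=> j; rewrite inE => ji.
rewrite dfwith_out 1?eq_sym//.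
exact: bounded_linear0 (bounded_linear_adjoint (Ll j)).
Qed.

End delta.

(** * Existence and uniqueness of the dual *)

Theorem theorem2p5 (R : realType) (k : scalar_kind) (H K : hilbertType R k)
    (sepH : separable H) (sepK : separable K)
    (I : set int) (K_ : I -> closed_subspace K)
    (Lambda Gamma : forall i : I, H -> K_ i)
    (u : forall i : I, K_ i -> K_ i) :
  gframe Lambda -> gframe Gamma ->
  bounded_diag u -> semi_normalized u ->
  invertible (multiplier u Lambda Gamma) ->
  exists! Gammad : forall i : I, H -> K_ i,
    dual_gframe Gamma Gammad /\
    forall Lambdad : forall i : I, H -> K_ i,
      dual_gframe Lambda Lambdad ->
      inverse (multiplier u Lambda Gamma) =
      multiplier (diag_inv u) Gammad Lambdad.
Proof.
move=> /gframe_bessel[B LB] /gframe_bessel[C GC] [ul ub] [ui vb].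
set M := multiplier _ _ _ => -[Mbij Nl]; set N := inverse M in Nl *.
have NM : cancel M N := inverseKV Mbij.
have MN : cancel N M := inverseK Mbij.
have vl i : bounded_linear (diag_inv u (i := i)) := (ui i).2.
have uK i : cancel (u i) (diag_inv u (i := i)) := inverseKV (ui i).1.
have vK i : cancel (diag_inv u (i := i)) (u i) := inverseK (ui i).1.
have [a a0 ua] := diag_bound ul ub.
have [b b0 Nb] := bounded_linear_bound Nl.
have ul2 y : l2 y -> l2 (diag u y) by case: ub => D /[apply] -[].
have vl2 y : l2 y -> l2 (diag (diag_inv u) y) by case: vb => D /[apply] -[].
have [Ll B0 LB'] := LB; have [Gl C0 GC'] := GC.
pose Gd (i : I) : H -> K_ i := adjoint (u i) \o Lambda i \o adjoint N.
have GdB : bessel Gd (a ^+ 2 * (B * b ^+ 2) + 1).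
  apply: (bessel_comp LB _ _ a0 (ltW b0) _ _) => [i||i|].
  - exact: bounded_linear_adjoint.
  - exact: bounded_linear_adjoint.
  - exact: hnorm_adjoint (ul i) a0 (ua i).
  - exact: hnorm_adjoint Nl (ltW b0) Nb.
have [Gdl _ _] := GdB.
have GdE i : adjoint (Gd i) = N \o adjoint (Lambda i) \o u i.
  apply: adjoint_unique => // x y.
  apply: etrans (hdot_adjointl (ul i) _ _) _.
  exact: etrans (adjointP (Ll i) _ _) (hdot_adjointl Nl _ _).
have synGd y : l2 y -> synthesis_op Gd y = N (synthesis_op Lambda (diag u y)).
  move=> yl; apply: (synthesis_comp LB GdB Nl _ (ul2 _ yl)) => i z.
  by rewrite GdE.
have uvK y : diag u (diag (diag_inv u) y) = y.
  by apply: functional_extensionality_dep => i; exact: vK.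
have vuK y : diag (diag_inv u) (diag u y) = y.
  by apply: functional_extensionality_dep => i; exact: uK.
have synGdv y : l2 y ->
    synthesis_op Gd (diag (diag_inv u) y) = N (synthesis_op Lambda y).
  by move=> yl; rewrite synGd ?uvK//; exact: vl2.
exists Gd; split.
  split.
    apply: (dual_gframe_bessel GC GdB).
    apply: (synthesis_analysis_swap GdB GC) => x.
    by rewrite synGd ?NM//; exact: analysis_l2 GC.
  (* Here $T_{Gd} U^{-1} = N T_\Lambda$, and $T_\Lambda T_{Ld}^* = Id$ leaves only [N]. *)
  move=> Ld [/gframe_bessel[D LdD] LLd]; apply/funext => x.
  by rewrite /multiplier /= synGdv ?LLd//; exact: analysis_l2 LdD.
move=> G' [[/gframe_bessel[D GD'] _] G'E]; have [Gl' _ _] := GD'.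
(* A nonzero [h] is needed to form the rank-one perturbations. *)
have [H0|[h h0]] : (forall x : H, x = 0) \/ exists h : H, h != 0.
  have [[h h0]|/forallNP H0] := pselect (exists h : H, h != 0).
    by right; exists h.
  by left=> x; apply/eqP/negPn/negP/H0.
  apply: functional_extensionality_dep => i; apply/funext => x.
  by rewrite (H0 x) !bounded_linear0.
pose Cd (i : I) : H -> K_ i := u i \o Gamma i \o N.
have CdB : bessel Cd (a ^+ 2 * (C * b ^+ 2) + 1).
  by apply: bessel_comp => //; exact: ltW.
have [Cdl _ CdB'] := CdB.
(* By conversion the left-hand side is [M (N x)]. *)
have LCd x : synthesis_op Lambda (analysis_op Cd x) = x by exact: MN.
have dCd : dual_gframe Lambda Cd := dual_gframe_bessel LB CdB LCd.
have key z : l2 z -> synthesis_op Lambda z = 0 ->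
    synthesis_op G' (diag (diag_inv u) z) = 0.
  move=> zl Lz.
  have hl : 0 < scalar_re (hdot h h).
    by rewrite -/(rdot h h) rdotxx exprn_gt0// lt_def hnorm_ge0 andbT;
      apply: contra h0 => /eqP /hnorm0_eq0 ->.
  pose Ld (i : I) (x : H) : K_ i := Cd i x + hdot x h *: z i.
  have [E LdE] : exists E, bessel Ld E := bessel_add_rank1 h CdB zl.
  have LLd x : synthesis_op Lambda (analysis_op Ld x) = x.
    rewrite [LHS](synthesisD LB (analysis_l2 x CdB) (l2Z _ zl)) LCd.
    by rewrite (synthesisZ _ LB zl) Lz scaler0 addr0.
  (* The formula gives the same operator for [Cd] and [Ld]. At [h] the two sides differ by
     [hdot h h] times the vector claimed to vanish. *)
  have := congr1 (@^~ h) (G'E _ (dual_gframe_bessel LB LdE LLd)).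
  rewrite (G'E _ dCd) /multiplier /=.
  have -> : diag (diag_inv u) (analysis_op Ld h) =
      fun i => diag (diag_inv u) (analysis_op Cd h) i
               + hdot h h *: diag (diag_inv u) z i.
    apply: functional_extensionality_dep => i.
    by rewrite /diag /analysis_op (bounded_linearD (vl i)) (bounded_linearZ (vl i)).
  rewrite (synthesisD GD' (vl2 _ (analysis_l2 h CdB)) (l2Z _ (vl2 _ zl))).
  rewrite (synthesisZ _ GD' (vl2 _ zl)) => /eqP.
  rewrite -subr_eq0 opprD addNKr oppr_eq0 scaler_eq0 => /orP[/eqP hh0|/eqP//].
  by rewrite hh0 scalar_re0 ltxx in hl.
have synG' y : l2 y ->
    synthesis_op G' (diag (diag_inv u) y) = N (synthesis_op Lambda y).
  (* The difference [y - analysis_op Cd w] lies in the kernel of $T_\Lambda$, so [key] replaces [y]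
     by [analysis_op Cd w]; the formula for the dual [Cd] then gives [N w]. *)
  move=> yl; set w := synthesis_op Lambda y.
  have cl := analysis_l2 w CdB; have ncl := l2Z (-1) cl.
  have zl := l2D yl ncl.
  have := key _ zl; rewrite (synthesisD LB yl ncl) (synthesisZ _ LB cl) LCd.
  rewrite scaleN1r subrr => /(_ erefl).
  have -> : diag (diag_inv u) (fun i => y i + -1 *: analysis_op Cd w i) =
      fun i => diag (diag_inv u) y i
               + -1 *: diag (diag_inv u) (analysis_op Cd w) i.
    apply: functional_extensionality_dep => i.
    by rewrite /diag (bounded_linearD (vl i)) (bounded_linearZ (vl i)).
  rewrite (synthesisD GD' (vl2 _ yl) (l2Z _ (vl2 _ cl))).
  rewrite (synthesisZ _ GD' (vl2 _ cl)) scaleN1r => /eqP.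
  by rewrite subr_eq0 => /eqP ->; rewrite (G'E _ dCd).
apply: functional_extensionality_dep => i.
rewrite -(adjointK (Gdl i)) -(adjointK (Gl' i)); congr adjoint.
apply/funext => v.
have dl := l2_bound (sqr_sum_bound_delta v).
(* Writing [delta v] as $U^{-1} U$ of itself brings both sides to $N T_\Lambda U$ applied to it. *)
by rewrite -!synthesis_delta// -[delta v]vuK synGdv ?synG'//; exact: ul2.
Qed.
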